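(* Let $\mu\in\mathcal{D}\subset\mathbb{R}^d$ be given. Let $E(\mu)\in\mathbb{R}^{n\times n}$ be symmetric and positive definite, let $A(\mu)\in\mathbb{R}^{n\times n}$ be such that $A^S(\mu):=\frac12\big(A(\mu)+A(\mu)^{\mathrm T}\big)$ is negative definite, and let $G(\mu)\in\mathbb{R}^{n\times q}$ have full column rank. Put $$\mathbf{E}(\mu):=\begin{bmatrix} E(\mu) & 0 \\ 0 & 0 \end{bmatrix},\qquad \mathbf{A}(\mu):=\begin{bmatrix} A(\mu) & G(\mu) \\ {G(\mu)}^{\mathrm T} & 0 \end{bmatrix}\in\mathbb{R}^{(n+q)\times(n+q)},$$ $$\boldsymbol{\mathcal{L}}(\mu):=-\mathbf{A}(\mu)\otimes\mathbf{E}(\mu)-\mathbf{E}(\mu)\otimes\mathbf{A}(\mu),$$ $$\Pi(\mu):=I_n-G(\mu)\big(G(\mu)^{\mathrm T}E(\mu)^{-1}G(\mu)\big)^{-1}G(\mu)^{\mathrm T}E(\mu)^{-1},$$ $$\boldsymbol{\Pi}_{\mathrm l}(\mu)=\boldsymbol{\Pi}_{\mathrm r}(\mu)^{\mathrm T}:=\begin{bmatrix} \Pi(\mu) & -\Pi(\mu)A(\mu)E(\mu)^{-1}G(\mu)\big(G(\mu)^{\mathrm T}E(\mu)^{-1}G(\mu)\big)^{-1} \\ 0 & 0 \end{bmatrix},$$ and $\boldsymbol{\Pi}_{\mathrm l}^{\otimes}(\mu):=\boldsymbol{\Pi}_{\mathrm l}(\mu)\otimes\boldsymbol{\Pi}_{\mathrm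 l}(\mu)$, $\boldsymbol{\Pi}_{\mathrm r}^{\otimes}(\mu):=\boldsymbol{\Pi}_{\mathrm r}(\mu)\otimes\boldsymbol{\Pi}_{\mathrm r}(\mu)$. Then $$\sigma_{\min}^{+}\big(\boldsymbol{\Pi}_{\mathrm l}^{\otimes}(\mu)\,\boldsymbol{\mathcal{L}}(\mu)\,\boldsymbol{\Pi}_{\mathrm r}^{\otimes}(\mu)\big)\;\geq\;2\,\lambda_{\min}(E(\mu))\,\lambda_{\min}\big(-A^S(\mu)\big).$$
   Context: $\otimes$ denotes the Kronecker product. $\sigma_{\min}^{+}(X)$ denotes the smallest positive singular value of a (nonzero) matrix $X$. $\lambda_{\min}(X)$ denotes the smallest eigenvalue of a symmetric matrix $X$. The matrices come from the Stokes-like differential-algebraic system $\frac{\mathrm d}{\mathrm dt}\mathbf{E}(\mu)\mathbf{z}(t)=\mathbf{A}(\mu)\mathbf{z}(t)+\mathbf{B}(\mu)u(t)$. *)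

(* Defs.v *)
From HB Require Import structures.
From mathcomp Require Import all_boot all_order all_algebra.
From mathcomp Require Import all_classical all_reals.
From mathcomp Require Export mxtens.

Set Implicit Arguments.
Unset Strict Implicit.
Unset Printing Implicit Defensive.

Import Order.TTheory GRing.Theory Num.Theory.

Local Open Scope classical_set_scope.
Local Open Scope ring_scope.

Definition posdefmx (R : realType) n (X : 'M[R]_n) : Prop :=
  forall v : 'cV[R]_n, v != 0 -> 0 < (v^T *m X *m v) 0 0.

Definition negdefmx (R : realType) n (X : 'M[R]_n) : Prop :=
  forall v : 'cV[R]_n, v != 0 -> (v^T *m X *m v) 0 0 < 0.

Definition sympart (R : realType) n (X : 'M[R]_n) : 'M[R]_n :=
  2^-1 *: (X + X^T).

(* The value is the junk 0 when S has no least element. *)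
Definition least (R : realType) (S : set R) : R := xget 0 (S `&` lbound S).

(* Meaningful for symmetric X of size n > 0. *)
Definition lambda_min (R : realType) n (X : 'M[R]_n) : R :=
  least [set a | eigenvalue X a].

Definition singular_value (R : realType) m n (X : 'M[R]_(m, n)) (s : R) : Prop :=
  0 <= s /\ eigenvalue (X^T *m X) (s ^+ 2).

(* Meaningful for X != 0 only: the zero matrix has no positive singular
   value. *)
Definition sigma_min_pos (R : realType) m n (X : 'M[R]_(m, n)) : R :=
  least [set s | 0 < s /\ singular_value X s].

Definition blockE (R : realType) n q (E : 'M[R]_n) : 'M[R]_(n + q) :=
  block_mx E 0 0 0.

Definition blockA (R : realType) n q (A : 'M[R]_n) (G : 'M[R]_(n, q)) :
    'M[R]_(n + q) :=
  block_mx A G G^T 0.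

Definition lyapmx (R : realType) m (E A : 'M[R]_m) : 'M[R]_(m * m) :=
  - (A *t E) - E *t A.

Definition schurG (R : realType) n q (E : 'M[R]_n) (G : 'M[R]_(n, q)) : 'M[R]_q :=
  G^T *m invmx E *m G.

Definition projPi (R : realType) n q (E : 'M[R]_n) (G : 'M[R]_(n, q)) : 'M[R]_n :=
  1%:M - G *m invmx (schurG E G) *m G^T *m invmx E.

Definition projl (R : realType) n q (E A : 'M[R]_n) (G : 'M[R]_(n, q)) :
    'M[R]_(n + q) :=
  let P := projPi E G in
  block_mx P (- (P *m A *m invmx E *m G *m invmx (schurG E G))) 0 0.

Definition projr (R : realType) n q (E A : 'M[R]_n) (G : 'M[R]_(n, q)) :
    'M[R]_(n + q) :=
  (projl E A G)^T.

Definition projected_lyapmx (R : realType) n q (E A : 'M[R]_n)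
    (G : 'M[R]_(n, q)) : 'M[R]_((n + q) * (n + q)) :=
  (projl E A G *t projl E A G)
    *m lyapmx (blockE q E) (blockA A G)
    *m (projr E A G *t projr E A G).

(* Main.v *)
(* The first projector factors as col_mx Pi 0 times [1 | *], and Pi G = 0, so
   the projected operator is T L T^T with T = Q (x) Q, Q = col_mx Pi 0 and
   L = - A (x) E - E (x) A. An eigenvector x of M^T M for the smallest positive
   eigenvalue s^2 lies in the range of M^T, hence in that of T, and
   s |x|^2 >= x^T M x by Cauchy-Schwarz. With y = T^T x,
   x^T M x = y^T L y >= 2 lambda_min(E) lambda_min(-A^S) |y|^2, and |y| >= |x|
   because x is fixed by the (oblique) idempotent T U, U a left inverse of the
   padding, while y has the norm of (T U)^T x. *)
Require Import Defs.
From mathcomp Require Import all_boot all_order all_algebra spectral complex.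
From mathcomp Require Import all_classical all_reals.
From mathcomp Require Import ring lra.

Set Implicit Arguments.
Unset Strict Implicit.
Unset Printing Implicit Defensive.

Import Order.TTheory GRing.Theory Num.Theory.

Local Open Scope classical_set_scope.
Local Open Scope ring_scope.

(** * Spectral decomposition of real symmetric matrices, through complexification *)

Lemma Re_gramC (R : realType) m n (F : 'M[R[i]]_(m, n)) :
  map_mx (@complex.Re R) ((map_mx Num.conj F)^T *m F)
  = (col_mx (map_mx (@complex.Re R) F) (map_mx (@complex.Im R) F))^T
    *m col_mx (map_mx (@complex.Re R) F) (map_mx (@complex.Im R) F).
Proof.
rewrite tr_col_mx mul_row_col; apply/matrixP => i j; rewrite !mxE.
rewrite (big_morph (@complex.Re R) (id1 := 0) (op1 := +%R)) //; last by case=> ? ? [].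
rewrite -big_split; apply: eq_bigr => k _; rewrite !mxE.
by case: (F k i) => a b; case: (F k j) => c d /=; rewrite mulNr opprK.
Qed.

(** Over [R[i]] the matrix is Hermitian, hence unitarily diagonalisable with real diagonal. The Gram
    clause stands in for the Rayleigh quotient bound; [K] has twice as many rows as [S] because a
    complex square root is split into real and imaginary parts. The last clause later supplies a
    positive singular value. *)
Lemma symmetric_spectral (R : realType) n (S : 'M[R]_n) : S^T = S ->
  exists r : 'I_n -> R,
    [/\ forall a, eigenvalue S a <-> exists i, r i = a,
        forall c, (forall i, c <= r i) ->
          exists K : 'M[R]_(n + n, n), S - c%:M = K^T *m K
      & S != 0 -> exists i, r i != 0].
Proof.
move=> Ssym; pose f : {rmorphism R -> R[i]} := real_complex R.
pose SC := map_mx f S.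
have herm : SC \is hermsymmx.
  apply: realsym_hermsym.
    by apply/is_hermitianmxP; rewrite expr0 scale1r map_mx_id // /SC map_trmx Ssym.
  by apply/mxOverP => i j; rewrite mxE; apply/complex_realP; exists (S i j).
have := hermitian_normalmx herm => /orthomx_spectralP SCE.
have spreal := hermitian_spectral_diag_real herm.
have Punit := spectral_unit SC; have Pinv := invmx_unitary (spectral_unitarymx SC).
move: (spectralmx SC) (spectral_diag SC) SCE spreal Punit Pinv.
move=> P sp SCE spreal Punit Pinv.
pose r i := complex.Re (sp 0 i).
have spE i : sp 0 i = f (r i) by rewrite /f /= RRe_real //; apply: (mxOverP spreal).
exists r; split.
- move=> a; rewrite -(eigenvalue_map f) -/SC; split.
    case/eigenvalueP => v vS v0.
    (* A nonzero coordinate [j] of [v] in the eigenbasis forces [a = r j]. *)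
    have : v *m invmx P != 0.
      by apply: contraNneq v0 => v0; rewrite -(mulmxKV Punit v) v0 mul0mx.
    case/matrix0Pn => i [j]; rewrite (ord1 i) => wj; exists j.
    apply: (fmorph_inj f); apply: (mulIf wj).
    have := congr1 (fun x => (x *m invmx P) 0 j) vS.
    rewrite /SCE SCE !mulmxA mulmxK // -scalemxAl mul_mx_diag !mxE => <-.
    by rewrite spE mulrC.
  case=> i <-; apply/eigenvalueP; exists (row i P); last first.
    apply/eqP => /(congr1 (mulmx^~ (invmx P))); rewrite -row_mul mulmxV // mul0mx.
    by move/rowP/(_ i); rewrite !mxE eqxx => /eqP; rewrite oner_eq0.
  by rewrite SCE -row_mul !mulmxA mulmxV // mul1mx row_mul row_diag_mx -scalemxAl -rowE spE.
- move=> c cr.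
  (* As [r i - c >= 0], these roots are real, so the conjugate transpose of [F] times [F] is
     [S - c I]. *)
  pose F := diag_mx (\row_i sqrtC (f (r i - c))) *m P.
  exists (col_mx (map_mx (@complex.Re R) F) (map_mx (@complex.Im R) F)); rewrite -Re_gramC.
  suff -> : (map_mx Num.conj F)^T *m F = map_mx f (S - c%:M).
    by apply/matrixP => i j; rewrite !mxE.
  rewrite map_mxB map_scalar_mx -/SC SCE -[(f c)%:M](mulmxKV Punit) mul_scalar_mx.
  rewrite -[_ *: invmx P]mul_mx_scalar -mulmxBl -mulmxBr.
  rewrite /F map_mxM trmx_mul map_diag_mx tr_diag_mx Pinv mulmxA -map_trmx.
  rewrite -[_ *m diag_mx _ *m diag_mx _]mulmxA; congr (_ *m _ *m _).
  rewrite mulmx_diag -diag_const_mx -raddfB; congr diag_mx.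
  apply/rowP => i; rewrite !mxE spE -rmorphB.
  rewrite mulrC -normCK ger0_norm ?sqrtC_ge0 ?ler0c ?subr_ge0 //.
  by rewrite sqrtCK.
- move=> S0; apply: contrapT => /forallNP r0; case/eqP: S0.
  apply: (map_mx_inj (f := f)); rewrite map_mx0 -/SC SCE.
  suff -> : sp = 0 by rewrite linear0 mulmx0 mul0mx.
  apply/rowP => i; rewrite spE mxE.
  by have /negP := r0 i; rewrite negbK => /eqP ->; rewrite rmorph0.
Qed.

(** * Gram matrices and quadratic forms *)

Lemma gram_diag_ge0 (R : realType) m n (K : 'M[R]_(m, n)) i :
  0 <= (K^T *m K) i i.
Proof. by rewrite mxE sumr_ge0 // => k _; rewrite mxE -expr2 sqr_ge0. Qed.

Lemma gram_eq0 (R : realType) m n (K : 'M[R]_(m, n)) :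
  (K^T *m K == 0) = (K == 0).
Proof.
apply/eqP/eqP => [K0|->]; last by rewrite mulmx0.
apply/matrixP => i j; have := congr1 (fun M : 'M_n => M j j) K0; rewrite !mxE.
under eq_bigr do rewrite mxE -expr2.
move=> /eqP; rewrite psumr_eq0 => [/allP/(_ i)|k _]; last exact: sqr_ge0.
by rewrite mem_index_enum sqrf_eq0 => /(_ isT) /eqP.
Qed.

Lemma dotmx_eq0 (R : realType) n (v : 'cV[R]_n) :
  ((v^T *m v) 0 0 == 0) = (v == 0).
Proof.
rewrite -gram_eq0; apply/eqP/eqP => [v0|->]; last by rewrite mxE.
by rewrite [LHS]mx11_scalar v0 raddf0.
Qed.

Lemma dotmx_gt0 (R : realType) n (v : 'cV[R]_n) :
  v != 0 -> 0 < (v^T *m v) 0 0.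
Proof. by move=> v0; rewrite lt_def gram_diag_ge0 dotmx_eq0 v0. Qed.

Lemma qform_tr (R : realType) n (M : 'M[R]_n) (v : 'cV[R]_n) :
  (v^T *m M^T *m v) 0 0 = (v^T *m M *m v) 0 0.
Proof.
have <- : (v^T *m M *m v)^T = v^T *m M^T *m v by rewrite !trmx_mul trmxK mulmxA.
by rewrite mxE.
Qed.

Lemma qform_gram (R : realType) m n (K : 'M[R]_(m, n)) (v : 'cV[R]_n) :
  (v^T *m (K^T *m K) *m v) 0 0 = ((K *m v)^T *m (K *m v)) 0 0.
Proof. by rewrite trmx_mul !mulmxA. Qed.

(** * Smallest eigenvalues and smallest positive singular values *)

Lemma eigenvalue_cV (R : realType) n (S : 'M[R]_n) a : S^T = S ->
  eigenvalue S a -> exists2 v : 'cV[R]_n, v != 0 & S *m v = a *: v.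
Proof.
move=> Ssym /eigenvalueP[v vS v0]; exists v^T; first by rewrite trmx_eq0.
by rewrite -[S in LHS]Ssym -trmx_mul vS linearZ.
Qed.

(* If there is no eigenvalue (n = 0), lambda_min is the junk value 0. *)
Lemma posdef_lambda_min (R : realType) n (S : 'M[R]_n) :
  S^T = S -> posdefmx S ->
  0 <= lambda_min S /\
  forall c, c <= lambda_min S ->
    exists K : 'M[R]_(n + n, n), S - c%:M = K^T *m K.
Proof.
move=> Ssym Spos; have [r [rE rK _]] := symmetric_spectral Ssym.
have r_gt0 i : 0 < r i.
  have [v v0 Sv] := eigenvalue_cV Ssym ((rE (r i)).2 (ex_intro _ i erefl)).
  have := Spos v v0; rewrite -mulmxA Sv -scalemxAr mxE.
  by rewrite pmulr_lgt0 // dotmx_gt0.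
(* In the default branch of [xget], the value 0 still bounds every [r i] from below by
   positivity. *)
have [l0 lr] : 0 <= lambda_min S /\ forall i, lambda_min S <= r i.
  rewrite /lambda_min /least; case: xgetP => [l _ [/rE[j <-] lb]|_].
    by split=> [|i]; [exact: ltW | apply/lb/rE; exists i].
  by split=> // i; exact: ltW.
by split=> // c cl; apply: rK => i; apply: le_trans cl (lr i).
Qed.

(** The nonzero matrix [X^T X] has finitely many eigenvalues, not all zero; the root of the least
    nonzero one is the least positive singular value, so [xget] does not return its default. *)
Lemma sigma_min_posP (R : realType) m n (X : 'M[R]_(m, n)) : X != 0 ->
  0 < sigma_min_pos X /\
  exists2 x : 'cV[R]_n, x != 0 & X^T *m X *m x = sigma_min_pos X ^+ 2 *: x.
Proof.
move=> X0; set S := X^T *m X.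
have Ssym : S^T = S by rewrite trmx_mul trmxK.
have [r [rE _ /(_ _)[|i0 ri0]]] := symmetric_spectral Ssym.
  by rewrite gram_eq0.
have r_ge0 i : 0 <= r i.
  have [v v0 Sv] := eigenvalue_cV Ssym ((rE (r i)).2 (ex_intro _ i erefl)).
  have := gram_diag_ge0 (X *m v) 0; rewrite -qform_gram -mulmxA Sv -scalemxAr mxE.
  by rewrite pmulr_lge0 // dotmx_gt0.
case: (@arg_minP _ _ _ i0 (fun i => r i != 0) r ri0) => i ri rmin.
have ri_gt0 : 0 < r i by rewrite lt_def ri r_ge0.
have : [set s | 0 < s /\ singular_value X s]
    `&` lbound [set s | 0 < s /\ singular_value X s] !=set0.
  exists (Num.sqrt (r i)); split.
    split; first by rewrite sqrtr_gt0.
    by split; [exact: sqrtr_ge0 | apply/rE; exists i; rewrite sqr_sqrtr].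
  move=> s [s0 [_ /rE[j rj]]].
  rewrite -(ger0_norm (ltW s0)) -sqrtr_sqr ler_sqrt ?sqr_ge0 // -rj.
  by apply: rmin; rewrite rj expf_neq0 // gt_eqF.
case=> s Ps; have [[s0 [_ ev]] _] := xgetPex 0 (ex_intro _ s Ps).
by split=> //; exact: eigenvalue_cV.
Qed.

(** * Lower bounds for Kronecker products and oblique idempotents *)

Lemma tensmx1 (R : realType) m n : (1%:M : 'M[R]_m) *t (1%:M : 'M[R]_n) = 1%:M.
Proof.
apply/matrixP => k l; rewrite -[k]mxtens_unindexK -[l]mxtens_unindexK.
case: (mxtens_unindex k) (mxtens_unindex l) => i1 i2 [j1 j2].
by rewrite tensmxE !mxE (can_eq (@mxtens_indexK m n)) xpair_eqE -natrM mulnb.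
Qed.

(* E (x) N - e n I = (E - e I) (x) N + e I (x) (N - n I), a sum of Kronecker
   products of Gram matrices. *)
Lemma qform_tens_ge (R : realType) m n (E : 'M[R]_m) (N : 'M[R]_n)
    (y : 'cV[R]_(m * n)) :
  E^T = E -> posdefmx E -> N^T = N -> posdefmx N ->
  lambda_min E * lambda_min N * (y^T *m y) 0 0 <= (y^T *m (E *t N) *m y) 0 0.
Proof.
move=> Esym Epos Nsym Npos.
have [e0 EK] := posdef_lambda_min Esym Epos.
have [l0 NK] := posdef_lambda_min Nsym Npos.
move: (lambda_min E) (lambda_min N) e0 l0 EK NK => e l e0 l0 EK NK.
have [K1 E1] := EK _ (lexx e).
(* The shift 0 is admissible since [0 <= l]: [K2] factors [N] itself, [K3] factors [N - l I]. *)
have [K2 N2] := NK _ l0; have [K3 N3] := NK _ (lexx l).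
have -> : E *t N = (K1 *t K2)^T *m (K1 *t K2)
    + e *: ((1%:M *t K3)^T *m (1%:M *t K3)) + (e * l) *: 1%:M.
  rewrite !trmx_tens !tensmx_mul -E1 -N2 -N3 trmx1 mulmx1 -(tensmx1 R m n).
  by apply/matrixP => i j; rewrite !mxE; ring.
rewrite !mulmxDr !mulmxDl -!scalemxAr -!scalemxAl mulmx1.
have entryD (a b : 'M[R]_1) : (a + b) 0 0 = a 0 0 + b 0 0 by rewrite mxE.
have entryZ c (a : 'M[R]_1) : (c *: a) 0 0 = c * a 0 0 by rewrite mxE.
rewrite !entryD !entryZ !qform_gram.
by rewrite lerDr addr_ge0 ?mulr_ge0 // gram_diag_ge0.
Qed.

(* |P^T x - x|^2 >= 0, where x . P^T x = P x . x = |x|^2. *)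
Lemma dotmx_le_tr_idem (R : realType) n (P : 'M[R]_n) (x : 'cV[R]_n) :
  P *m x = x -> (x^T *m x) 0 0 <= ((P^T *m x)^T *m (P^T *m x)) 0 0.
Proof.
move=> Px; have := gram_diag_ge0 (P^T *m x - x) 0.
rewrite mulmxBr linearB /= !mulmxBl trmx_mul trmxK.
rewrite -[x^T *m P *m x]mulmxA Px [x^T *m (P^T *m x)]mulmxA -trmx_mul Px.
by rewrite subrr subr0 mxE [X in _ + X]mxE subr_ge0.
Qed.

(** * The projectors and the reduction to a congruence of the n-dimensional operator *)

Lemma posdef_unitmx (R : realType) n (S : 'M[R]_n) : posdefmx S -> S \in unitmx.
Proof.
move=> Spos; rewrite -row_free_unit -kermx_eq0; apply/rowV0P => v.
move=> /sub_kermxP vS; apply/eqP; apply: contraT => v0.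
have := Spos v^T; rewrite trmx_eq0 trmxK => /(_ v0).
by rewrite vS mul0mx mxE ltxx.
Qed.

(** The form of [schurG] at [v] is the form of [E] at [w = E^-1 G v], and [w] is nonzero because [G]
    is injective. *)
Lemma schurG_unitmx (R : realType) n q (E : 'M[R]_n) (G : 'M[R]_(n, q)) :
  E^T = E -> posdefmx E -> \rank G = q -> schurG E G \in unitmx.
Proof.
move=> Esym Epos Grank; apply: posdef_unitmx => v v0.
have Eunit := posdef_unitmx Epos.
have -> : v^T *m schurG E G *m v
    = (invmx E *m (G *m v))^T *m E *m (invmx E *m (G *m v)).
  by rewrite !trmx_mul trmx_inv Esym /schurG !mulmxA mulmxKV.
apply: Epos; apply: contraNneq v0 => w0.
have Gv0 : G *m v = 0 by rewrite -(mulKVmx Eunit (G *m v)) w0 mulmx0.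
have GTfree : row_free G^T by rewrite /row_free mxrank_tr Grank.
by rewrite -trmx_eq0 -(mulmx_free_eq0 _ GTfree) -trmx_mul Gv0 trmx0.
Qed.

Lemma projPi_mulG (R : realType) n q (E : 'M[R]_n) (G : 'M[R]_(n, q)) :
  schurG E G \in unitmx -> projPi E G *m G = 0.
Proof.
move=> Sunit; rewrite /projPi mulmxBl mul1mx -!mulmxA [G^T *m _]mulmxA.
by rewrite -/(schurG E G) mulVmx // mulmx1 subrr.
Qed.

Lemma projPi_idem (R : realType) n q (E : 'M[R]_n) (G : 'M[R]_(n, q)) :
  schurG E G \in unitmx -> projPi E G *m projPi E G = projPi E G.
Proof.
move=> Sunit; rewrite [X in _ *m X]/projPi mulmxBr mulmx1 !mulmxA.
by rewrite projPi_mulG // !mul0mx subr0.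
Qed.

Lemma projl_blockE (R : realType) n q (E A : 'M[R]_n) (G : 'M[R]_(n, q)) :
  projl E A G *m blockE q E *m (projl E A G)^T
  = col_mx (projPi E G) 0 *m E *m (col_mx (projPi E G) 0 : 'M_(n + q, n))^T.
Proof.
rewrite /projl /blockE tr_block_mx tr_col_mx !mulmx_block mul_col_mx mul_col_row.
by rewrite !trmx0 !(mulmx0, mul0mx, addr0).
Qed.

(** The block [G] is met from the left as [Pi G], the block [G^T] from the right as [(Pi G)^T]; both
    vanish. *)
Lemma projl_blockA (R : realType) n q (E A : 'M[R]_n) (G : 'M[R]_(n, q)) :
  schurG E G \in unitmx ->
  projl E A G *m blockA A G *m (projl E A G)^T
  = col_mx (projPi E G) 0 *m A *m (col_mx (projPi E G) 0 : 'M_(n + q, n))^T.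
Proof.
move=> Sunit.
rewrite /projl /blockA tr_block_mx tr_col_mx !mulmx_block mul_col_mx mul_col_row.
rewrite !trmx0 !(mulmx0, mul0mx, addr0) projPi_mulG // mul0mx addr0.
by rewrite mulmxDl -[_ *m G^T *m _]mulmxA -trmx_mul projPi_mulG // trmx0 mulmx0 addr0.
Qed.

Lemma tensmx_lyap (R : realType) m n (Q : 'M[R]_(m, n)) (E A : 'M[R]_n) :
  lyapmx (Q *m E *m Q^T) (Q *m A *m Q^T)
  = (Q *t Q) *m lyapmx E A *m (Q *t Q)^T.
Proof. by rewrite /lyapmx mulmxBr mulmxBl mulmxN mulNmx trmx_tens !tensmx_mul. Qed.

(** [tensmx_lyap] is used in both directions: it moves the congruence by [projl] inside the Lyapunov
    operator, where it becomes a congruence by [Q], and then moves [Q] back out. *)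
Lemma projected_lyapmxE (R : realType) n q (E A : 'M[R]_n) (G : 'M[R]_(n, q)) :
  let Q := col_mx (projPi E G) 0 : 'M_(n + q, n) in
  schurG E G \in unitmx ->
  projected_lyapmx E A G = (Q *t Q) *m lyapmx E A *m (Q *t Q)^T.
Proof.
move=> Q Sunit; rewrite -tensmx_lyap -(projl_blockE E A) -(projl_blockA A Sunit).
by rewrite /projected_lyapmx /projr -trmx_tens -tensmx_lyap.
Qed.

(** * Coercivity of the Lyapunov operator and the final estimate *)

Lemma trmx_sympart (R : realType) n (A : 'M[R]_n) : (sympart A)^T = sympart A.
Proof. by rewrite /sympart linearZ linearD /= trmxK addrC. Qed.

Lemma posdefmxN (R : realType) n (S : 'M[R]_n) : negdefmx S -> posdefmx (- S).
Proof. by move=> Sneg v v0; rewrite mulmxN mulNmx mxE oppr_gt0; apply: Sneg. Qed.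

(** A quadratic form only sees the symmetric part, here [E (x) N + N (x) E] with [N = - sympart A].
    Each summand contributes the product of the two smallest eigenvalues, whence the factor 2. *)
Lemma qform_lyap_ge (R : realType) n (E A : 'M[R]_n) (y : 'cV[R]_(n * n)) :
  E^T = E -> posdefmx E -> negdefmx (sympart A) ->
  2 * lambda_min E * lambda_min (- sympart A) * (y^T *m y) 0 0
    <= (y^T *m lyapmx E A *m y) 0 0.
Proof.
move=> Esym Epos Aneg; set N := - sympart A.
have Nsym : N^T = N by rewrite linearN /= trmx_sympart.
have Npos := posdefmxN Aneg; rewrite -/N in Npos.
have symL : lyapmx E A + (lyapmx E A)^T = 2 *: (E *t N + N *t E).
  rewrite /lyapmx !(linearN, linearB) /= !trmx_tens Esym /N /sympart.
  by apply/matrixP => k l; rewrite !mxE; field.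
have -> : (y^T *m lyapmx E A *m y) 0 0
    = (y^T *m (E *t N) *m y) 0 0 + (y^T *m (N *t E) *m y) 0 0.
  have : (y^T *m (lyapmx E A + (lyapmx E A)^T) *m y) 0 0
      = (y^T *m lyapmx E A *m y) 0 0 *+ 2.
    by rewrite mulmxDr mulmxDl mxE qform_tr.
  rewrite symL -scalemxAr -scalemxAl mulmxDr mulmxDl mxE mulr_natl mxE.
  by move=> /(pmulrnI (isT : (0 < 2)%N)) <-.
have H1 := qform_tens_ge y Esym Epos Nsym Npos.
have H2 := qform_tens_ge y Nsym Npos Esym Epos.
lra.
Qed.

(** Expand [|M x - s x|^2 >= 0] using [|M x|^2 = s^2 |x|^2], then divide by [2 s]. *)
Lemma qform_le_norm (R : realType) n (M : 'M[R]_n) (x : 'cV[R]_n) (s : R) :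
  0 < s -> M^T *m M *m x = s ^+ 2 *: x ->
  (x^T *m M *m x) 0 0 <= s * (x^T *m x) 0 0.
Proof.
move=> s0 Mx; have := gram_diag_ge0 (M *m x - s *: x) 0.
have entryB (a b : 'M[R]_1) : (a - b) 0 0 = a 0 0 - b 0 0 by rewrite !mxE.
have entryZ c (a : 'M[R]_1) : (c *: a) 0 0 = c * a 0 0 by rewrite mxE.
rewrite mulmxBr linearB /= !mulmxBl linearZ /= -!scalemxAr -!scalemxAl.
rewrite !(entryB, entryZ) -qform_gram -[x^T *m (M^T *m M) *m x]mulmxA Mx -scalemxAr.
rewrite entryZ trmx_mul qform_tr mulmxA => H.
rewrite -(ler_pM2l s0); lra.
Qed.

Theorem theorem4p4 (R : realType) (d n q : nat)
    (D : set 'rV[R]_d) (mu : 'rV[R]_d)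
    (E A : 'rV[R]_d -> 'M[R]_n) (G : 'rV[R]_d -> 'M[R]_(n, q))
    (Dmu : D mu)
    (Esym : (E mu)^T = E mu)
    (Epos : posdefmx (E mu))
    (Aneg : negdefmx (sympart (A mu)))
    (Grank : \rank (G mu) = q)
    (nz : projected_lyapmx (E mu) (A mu) (G mu) != 0) :
  2 * lambda_min (E mu) * lambda_min (- sympart (A mu))
    <= sigma_min_pos (projected_lyapmx (E mu) (A mu) (G mu)).
Proof.
have Sunit := schurG_unitmx Esym Epos Grank.
have [s0 [x x0 Mx]] := sigma_min_posP nz.
set c := (X in X <= _).
(* The sign of [c] lets [|x|^2 <= |y|^2] be multiplied by [c] at the end. *)
have c0 : 0 <= c.
  rewrite !mulr_ge0 //; first exact: (posdef_lambda_min Esym Epos).1.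
  by apply: (posdef_lambda_min _ (posdefmxN Aneg)).1; rewrite linearN /= trmx_sympart.
move: (sigma_min_pos _) s0 Mx => s s0 Mx.
rewrite -(ler_pM2r (dotmx_gt0 x0)); apply: le_trans (qform_le_norm s0 Mx).
move: Mx; rewrite (projected_lyapmxE _ Sunit).
set Q : 'M_(n + q, n) := col_mx _ _; set T := Q *t Q; set L := lyapmx _ _ => Mx.
(* [V] drops the zero padding: [V Q = Pi], so [Q V Q = Q] by idempotence of [Pi]. *)
pose V : 'M[R]_(n, n + q) := row_mx 1%:M 0; pose U := V *t V.
have QVQ : Q *m V *m Q = Q.
  rewrite -mulmxA mul_row_col mul1mx mul0mx addr0 mul_col_mx mul0mx.
  by rewrite projPi_idem.
have TUT : T *m U *m T = T by rewrite !tensmx_mul QVQ.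
have UUT : U *m U^T = 1%:M.
  by rewrite trmx_tens tensmx_mul tr_row_mx mul_row_col trmx1 trmx0 mulmx0 mulmx1 addr0 tensmx1.
(* [s^2 x = M^T M x] lies in the range of [T], since [M^T = T L^T T^T]; [T U] fixes that range. *)
have TUx : T *m U *m x = x.
  have s20 : s ^+ 2 != 0 by rewrite expf_neq0 // gt_eqF.
  apply: (scalerI s20); rewrite scalemxAr -Mx.
  by rewrite !trmx_mul trmxK !mulmxA TUT.
have xy := dotmx_le_tr_idem TUx.
have -> : x^T *m (T *m L *m T^T) *m x = (T^T *m x)^T *m L *m (T^T *m x).
  by rewrite trmx_mul trmxK !mulmxA.
apply: le_trans (qform_lyap_ge _ Esym Epos Aneg); rewrite -/c.
apply: ler_wpM2l => //; apply: le_trans xy _.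
(* [(T U)^T x = U^T y] with [y = T^T x], and [U^T] is an isometry because [U U^T = 1]. *)
by rewrite [(T *m U)^T]trmx_mul -[U^T *m _ *m x]mulmxA -(qform_gram U^T) trmxK UUT mulmx1.
Qed.
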